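(* Let $S_1 = (\mathcal{X}_1, \mathcal{U}_1, \rightsquigarrow_1)$ and $S_2 = (\mathcal{X}_2, \mathcal{U}_2, \rightsquigarrow_2)$ be discrete-time control systems, and let $R \subseteq \mathcal{X}_1 \times \mathcal{X}_2$ be an alternating simulation relation, with associated extended alternating simulation relation $R^e$, such that for each $x_2 \in \mathcal{X}_2$ there is exactly one $x_1 \in \mathcal{X}_1$ with $(x_1, x_2) \in R$; denote this $x_1$ by $R(x_2)$. Given a cost function $c_2$ for $S_2$, consider an associated cost function $c_1$ for $S_1$ satisfying $$c_1(x_1, u_1) \ge \max_{(x_1, x_2, u_1, u_2) \in R^e} c_2(x_2, u_2),$$ where for given $(x_1,u_1)$ the maximum is over all $(x_2,u_2)$ with $(x_1,x_2,u_1,u_2)\in R^e$. If $L_1$ is a Lyapunov function with cost function $c_1$ for $S_1$ (in a set $\mathcal{X}_f\subseteq\mathcal{X}_1$), then $L_2(x_2) = L_1(R(x_2))$ is a Lyapunov function with cost function $c_2$ for $S_2$ (in the set $\{x_2\in\mathcal{X}_2 : R(x_2)\in\mathcal{X}_f\}$).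
   Context: A discrete-time control system is a triple $S = (\mathcal{X}, \mathcal{U}, \rightsquigarrow)$ with state set $\mathcal{X}$, input set $\mathcal{U}$, and $\rightsquigarrow$ the set of transitions $(x,u,x')$ such that the system can reach $x'\in\mathcal{X}$ from $x\in\mathcal{X}$ with input $u\in\mathcal{U}$. $\mathrm{Post}_u(x)$ denotes the set of $x'$ such that $(x,u,x') \in\ \rightsquigarrow$; for $S_i$ it is written $\mathrm{Post}_{i,u}(x)$. Given a relation $R \subseteq \mathcal{X}_1\times \mathcal{X}_2$, the extended relation $R^e$ is the set of $(x_1,x_2,u_1,u_2)$ such that for every $x_2' \in \mathrm{Post}_{2,u_2}(x_2)$ there exists $x_1' \in \mathrm{Post}_{1,u_1}(x_1)$ with $(x_1', x_2') \in R$. If for all $(x_1,x_2) \in R$ and for all $u_1 \in \mathcal{U}_1$ there exists $u_2 \in \mathcal{U}_2$ such that $(x_1,x_2,u_1,u_2) \in R^e$, then $R$ is an alternating simulation relation and $R^e$ is its associated extended alternating simulation relation. A cost function is a function $c:\mathcal{X}\times\mathcal{U}\to\mathbb{R}$. Given $\mathcal{X}_f\subseteq\mathcal{X}$ and a cost function $c$, a function $L:\mathcal{X}\to\mathbb{R}\cup\{\infty\}$ is a Lyapunov function with cost function $c$ for $S$ in $\mathcal{X}_f$ if $L(x)=\infty$ for all $x\in\mathcal{X}\setminus\mathcal{X}_f$ and, for all $x\in\mathcal{X}_f$, $L(x)$ is finite and $L(x)\ge\mathcal{T}_cL(x)$, where $$\mathcal{T}_c L(x) = \min_{u \in \mathcal{U}}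 \Big( c(x,u) + \max_{x' \in \mathrm{Post}_u(x)} L(x') \Big).$$ *)

(* Defs.v *)
From HB Require Import structures.
From mathcomp Require Import all_boot all_order all_algebra.
From mathcomp Require Import boolp classical_sets reals ereal.
Set Implicit Arguments.
Unset Strict Implicit.
Unset Printing Implicit Defensive.
Local Open Scope classical_set_scope.
Local Open Scope ereal_scope.

Record control_system := ControlSystem {
  state : Type;
  input : Type;
  trans : set (state * input * state) }.

Definition Post (S : control_system) (u : input S) (x : state S) :
  set (state S) := [set x' | trans (x, u, x')].

Definition extended_relation (S1 S2 : control_system)
    (R : set (state S1 * state S2)) :
    set (state S1 * state S2 * input S1 * input S2) :=
  [set p | let: (x1, x2, u1, u2) := p in
    forall x2', Post u2 x2 x2' ->
      exists x1', Post u1 x1 x1' /\ R (x1', x2')].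

Definition alternating_simulation (S1 S2 : control_system)
    (R : set (state S1 * state S2)) : Prop :=
  forall x1 x2, R (x1, x2) ->
    forall u1 : input S1, exists u2 : input S2,
      extended_relation R (x1, x2, u1, u2).

(* The state written R(x2) when R relates every x2 to exactly one x1. *)
Definition related_state (S1 S2 : control_system)
    (R : set (state S1 * state S2))
    (R_unique : forall x2, exists! x1, R (x1, x2)) (x2 : state S2) : state S1 :=
  sval (cid (R_unique x2)).

(* The operator T_c. Nothing guarantees that the minimum and the maximum are
   attained, so they are the infimum and the supremum in the extended reals; the
   supremum over an empty set of successors is -oo. *)
Definition bellman (R : realType) (S : control_system)
    (c : state S -> input S -> R) (L : state S -> \bar R) (x : state S) :
    \bar R :=
  ereal_inf [set (c x u)%:E + ereal_sup [set L x' | x' in Post u x]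
            | u in [set: input S]].

(* The first two clauses force L to avoid -oo, i.e. to take its values in the
   reals extended by +oo only. *)
Definition lyapunov (R : realType) (S : control_system)
    (c : state S -> input S -> R) (Xf : set (state S))
    (L : state S -> \bar R) : Prop :=
  (forall x, ~ Xf x -> L x = +oo) /\
  (forall x, Xf x -> L x \is a fin_num /\ bellman c L x <= L x).

(* c1(x1, u1) >= max of c2(x2, u2) over all (x2, u2) with
   (x1, x2, u1, u2) in R^e, the maximum being a supremum in the extended reals
   (-oo if there is no such (x2, u2)). *)
Definition associated_cost (K : realType) (S1 S2 : control_system)
    (R : set (state S1 * state S2))
    (c1 : state S1 -> input S1 -> K) (c2 : state S2 -> input S2 -> K) : Prop :=
  forall x1 u1,
    ereal_sup [set (c2 p.1 p.2)%:E
              | p in [set p | extended_relation R (x1, p.1, u1, p.2)]]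
      <= (c1 x1 u1)%:E.

(* Main.v *)
(** The Bellman operator of [S2] at [x2] is dominated by that of [S1] at
    [R(x2)]: an input [u1] is matched by some [u2] that costs no more, and
    every successor of [x2] under [u2] is sent by [R] to a successor of
    [R(x2)] under [u1], so the worst case over successors does not grow. *)

Require Import Defs.
From HB Require Import structures.
From mathcomp Require Import all_boot all_order all_algebra.
From mathcomp Require Import boolp classical_sets reals ereal.
Import Order.TTheory.
Local Open Scope classical_set_scope.

Section RelatedState.
Set Implicit Arguments.
Unset Strict Implicit.

Variables (S1 S2 : control_system) (R : set (state S1 * state S2)).
Hypothesis R_unique : forall x2, exists! x1, R (x1, x2).

Lemma related_stateP x2 : R (related_state R_unique x2, x2).
Proof. by rewrite /related_state; case: cid => x1 []. Qed.

(** The uniqueness half of [R_unique]; it identifies the existential witness in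
    [extended_relation]. *)
Lemma related_state_eq x1 x2 : R (x1, x2) -> related_state R_unique x2 = x1.
Proof.
move=> Rx; rewrite /related_state; case: cid => y /= [_ y_unique].
exact: y_unique.
Qed.

(** The left set of values is included in the right one: the [x1'] that [extended_relation] gives
    for a successor [x2'] can only be R([x2']). *)
Lemma sup_related_state_le (K : realType) (L1 : state S1 -> \bar K)
    x1 x2 u1 u2 : extended_relation R (x1, x2, u1, u2) ->
  (ereal_sup [set L1 (related_state R_unique x) | x in Post u2 x2]
   <= ereal_sup [set L1 x | x in Post u1 x1])%E.
Proof.
move=> Re; apply: ereal_sup_le => _ [x2' /Re[x1' [x1'_post Rx']] <-].
by exists x1' => //; rewrite (related_state_eq Rx').
Qed.

Lemma bellman_related_state_le (K : realType)
    (c1 : state S1 -> input S1 -> K) (c2 : state S2 -> input S2 -> K)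
    (L1 : state S1 -> \bar K) x2 :
  alternating_simulation R -> associated_cost R c1 c2 ->
  (bellman c2 (L1 \o related_state R_unique) x2
   <= bellman c1 L1 (related_state R_unique x2))%E.
Proof.
move=> R_sim c1_c2; apply: le_ereal_inf_tmp => _ [u1 _ <-].
have [u2 Re] := R_sim _ _ (related_stateP x2) u1.
(* The cost in the middle term stays open here; choosing [u2] in the infimum makes it [c2 x2 u2]. *)
apply: le_trans (leeD _ (sup_related_state_le L1 Re)).
  by apply: ereal_inf_lbound; exists u2.
(* By [Re], [c2 x2 u2] is among the costs whose supremum [c1] dominates. *)
by apply: le_trans (c1_c2 _ u1); apply: ereal_sup_ubound; exists (x2, u2).
Qed.

End RelatedState.

Theorem theorem8 (K : realType) (S1 S2 : control_system)
    (R : set (state S1 * state S2))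
    (R_sim : alternating_simulation R)
    (R_unique : forall x2 : state S2, exists! x1 : state S1, R (x1, x2))
    (c2 : state S2 -> input S2 -> K) (c1 : state S1 -> input S1 -> K)
    (c1_c2 : associated_cost R c1 c2)
    (Xf : set (state S1)) (L1 : state S1 -> \bar K)
    (L1_lyapunov : lyapunov c1 Xf L1) :
  lyapunov c2 [set x2 | Xf (related_state R_unique x2)]
    (fun x2 => L1 (related_state R_unique x2)).
Proof.
case: L1_lyapunov => L1_out L1_in.
(* The new domain is the preimage of [Xf], so both clauses for [L1] apply at R([x2]). *)
split=> [x2 /L1_out //|x2 /L1_in[L1_fin L1_le]].
split=> //; apply: le_trans L1_le.
exact: bellman_related_state_le R_sim c1_c2.
Qed.
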